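(* Let $m\ge 2$, let $H\le \mathrm{Sym}(m)$, and let $G\le W_H\le \mathrm{Aut}~T_m$ be a regular branch group branching over a finite-index subgroup $K\le G$ (that is, $G$ is self-similar and level-transitive, and $K\le G$ is a finite-index branching subgroup). Put $\Omega(G:K):=\Omega(|G:K|)$. Then the closure $\overline{G}$ of $G$ in $W_H$ is regular branch over its $\Omega(G:K)$th level stabilizer $\mathrm{St}_{\overline{G}}(\Omega(G:K))$. Therefore the Hausdorff dimension of $\overline{G}$ in $W_H$ is $$\mathrm{hdim}_{W_H}(\overline{G})=\frac{1}{\log|H|}\left(\log|G_1|-\sum_{n=1}^{\Omega(G:K)}\frac{s_n(G)}{m^n}\right).$$ Furthermore, the logarithmic orders of the quotients $G_n$ are given by $$\log|G_n|=\alpha m^n+\beta$$ for all $n\ge \Omega(G:K)$, where $$\alpha:=\frac{\mathrm{hdim}_{W_H}(\overline{G})\cdot \log|H|}{m-1}\quad\text{and}\quad \beta:=\frac{\sum_{n=1}^{\Omega(G:K)}s_n(G)-\log|G_1|}{m-1}.$$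
   Context: All logarithms are in base $m$. Tree and automorphisms: for $m\ge 2$, $T_m$ is the rooted tree in which each vertex has exactly $m$ immediate descendants, identified with the free monoid on $\{1,\dots,m\}$; the $n$th level is the set of vertices at distance $n$ from the root. $\mathrm{Aut}~T_m$ is its group of graph automorphisms (acting on the right). For $f\in \mathrm{Aut}~T_m$ and a vertex $v$, the section $f|_v\in\mathrm{Aut}~T_m$ is the unique automorphism with $(vu)^f=v^fu^{f|_v}$ for every $u\in T_m$. There is an isomorphism $\psi:\mathrm{Aut}~T_m\to (\mathrm{Aut}~T_m\times\overset{m}{\dotsb}\times \mathrm{Aut}~T_m)\rtimes \mathrm{Sym}(m)$, $f\mapsto (f|_1,\dots,f|_m)\sigma_f$, where $\sigma_f$ is the permutation action of $f$ on the first level. Stabilizers: $\mathrm{St}(n)$ is the pointwise stabilizer in $\mathrm{Aut}~T_m$ of the $n$th level, and for $G\le \mathrm{Aut}~T_m$, $\mathrm{St}_G(n):=G\cap \mathrm{St}(n)$ (so $\mathrm{St}_G(0)=G$) and $G_n:=G/\mathrm{St}_G(n)$. Types of groups: $G\le\mathrm{Aut}~T_m$ is self-similar if $g|_v\in G$ for every $g\in G$ and every vertex $v$; level-transitive if it acts transitively on every level of $T_m$. A subgroup $K\le\mathrm{Aut}~T_m$ is branching if $\psi(K)\ge K\times\overset{m}{\dotsb}\times K$. A self-similar, level-transitive group $G$ is regular branch (over $K$) if it contains a finite-index branching subgroup $K\le G$. Iterated wreath product: for $H\le \mathrm{Sym}(m)$, $W_H\le\mathrm{Aut}~T_m$ is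 the closed subgroup of all automorphisms $f$ whose local action on the immediate descendants of each vertex $v$, i.e. $\sigma_{f|_v}$, is a permutation in $H$. Topology and Hausdorff dimension: $\mathrm{Aut}~T_m$ carries the congruence topology, in which $\{\mathrm{St}(n)\}_{n\ge1}$ is a base of open neighbourhoods of the identity; closures are taken in this topology. For a closed subgroup $G\le W_H$, $$\mathrm{hdim}_{W_H}(G)=\liminf_{n\to\infty}\frac{\log|G:\mathrm{St}_G(n)|}{\log|W_H:\mathrm{St}_{W_H}(n)|}.$$ Other notation: $\Omega:\mathbb{N}\to\mathbb{N}\cup\{0\}$ counts prime factors with multiplicity (so $\Omega(1)=0$). For $G\le\mathrm{Aut}~T_m$ and $n\ge 1$, $$s_n(G):=m \log |\mathrm{St}_G(n-1):\mathrm{St}_G(n)|-\log|\mathrm{St}_G(n):\mathrm{St}_G(n+1)|.$$ *)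

(* Defs.v *)
From HB Require Import structures.
From mathcomp Require Import all_boot all_order all_algebra all_fingroup.
From mathcomp Require Import zify finmap.
From mathcomp Require Import all_classical all_reals all_analysis.

Set Implicit Arguments.
Unset Strict Implicit.
Unset Printing Implicit Defensive.

Import Order.TTheory GRing.Theory Num.Theory.

Local Open Scope classical_set_scope.

(* A vertex of T_m is a word over 'I_m; the descendants of v are the words
   v ++ u, and the n-th level consists of the words of size n. *)
Definition vertex (m : nat) := seq 'I_m.

Definition tree_edge (m : nat) (u v : vertex m) : bool :=
  [exists i, v == rcons u i] || [exists i, u == rcons v i].

(* No condition is put on the root: every graph automorphism fixes it
   (lemma aut_root). *)
Record tree_aut (m : nat) := TreeAut {
  aut_fun :> vertex m -> vertex m;
  aut_bij : bijective aut_fun;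
  aut_edge : forall u v, tree_edge (aut_fun u) (aut_fun v) = tree_edge u v }.

HB.instance Definition _ (m : nat) := gen_eqMixin (tree_aut m).
HB.instance Definition _ (m : nat) := gen_choiceMixin (tree_aut m).

Lemma aut_eqP (m : nat) (f g : tree_aut m) : f =1 g -> f = g.
Proof.
case: f g => [f fb fe] [g gb ge] /= /funext fg; subst g.
by rewrite (Prop_irrelevance fb gb) (Prop_irrelevance fe ge).
Qed.

Definition aut_one (m : nat) : tree_aut m :=
  @TreeAut m id (inv_bij (fun=> erefl)) (fun _ _ => erefl).

Fact aut_mul_bij (m : nat) (f g : tree_aut m) : bijective (g \o f).
Proof. exact: bij_comp (aut_bij g) (aut_bij f). Qed.

Fact aut_mul_edge (m : nat) (f g : tree_aut m) u v :
  tree_edge ((g \o f) u) ((g \o f) v) = tree_edge u v.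
Proof. by rewrite /= !aut_edge. Qed.

(* Automorphisms act on the right, v ^ (f * g) = (v ^ f) ^ g, as permutations
   do in MathComp. *)
Definition aut_mul (m : nat) (f g : tree_aut m) : tree_aut m :=
  TreeAut (aut_mul_bij f g) (aut_mul_edge f g).

Fact aut_inv_subproof (m : nat) (f : tree_aut m) :
  exists g : tree_aut m, cancel f g /\ cancel g f.
Proof.
have [g fK gK] := aut_bij f.
have ge u v : tree_edge (g u) (g v) = tree_edge u v.
  by rewrite -(aut_edge f) !gK.
by exists (TreeAut (Bijective gK fK) ge).
Qed.

Definition aut_inv (m : nat) (f : tree_aut m) : tree_aut m :=
  projT1 (cid (aut_inv_subproof f)).

Lemma aut_invP (m : nat) (f : tree_aut m) :
  cancel f (aut_inv f) /\ cancel (aut_inv f) f.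
Proof. exact: projT2 (cid (aut_inv_subproof f)). Qed.

Fact aut_mulA (m : nat) : associative (@aut_mul m).
Proof. by move=> f g h; apply: aut_eqP. Qed.
Fact aut_mul1 (m : nat) : left_id (aut_one m) (@aut_mul m).
Proof. by move=> f; apply: aut_eqP. Qed.
Fact aut_mulr1 (m : nat) : right_id (aut_one m) (@aut_mul m).
Proof. by move=> f; apply: aut_eqP. Qed.
Fact aut_mulV (m : nat) : left_inverse (aut_one m) (@aut_inv m) (@aut_mul m).
Proof. by move=> f; apply: aut_eqP => v /=; exact: (aut_invP f).2. Qed.
Fact aut_mulrV (m : nat) : right_inverse (aut_one m) (@aut_inv m) (@aut_mul m).
Proof. by move=> f; apply: aut_eqP => v /=; exact: (aut_invP f).1. Qed.

HB.instance Definition _ (m : nat) := isGroup.Build (tree_aut m)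
  (@aut_mulA m) (@aut_mul1 m) (@aut_mulr1 m) (@aut_mulV m) (@aut_mulrV m).

Lemma tree_edgeP (m : nat) (u v : vertex m) :
  reflect ((exists i, v = rcons u i) \/ (exists i, u = rcons v i))
          (tree_edge u v).
Proof.
apply: (iffP orP) => -[].
- by move=> /existsP[i /eqP]; left; exists i.
- by move=> /existsP[i /eqP]; right; exists i.
- by move=> [i ->]; left; apply/existsP; exists i.
- by move=> [i ->]; right; apply/existsP; exists i.
Qed.

Lemma tree_edge_cat (m : nat) (w u v : vertex m) :
  tree_edge (w ++ u) (w ++ v) = tree_edge u v.
Proof.
rewrite /tree_edge; congr (_ || _); apply: eq_existsb => i;
  by rewrite rcons_cat eqseq_cat // eqxx.
Qed.

Lemma aut_root (m : nat) (f : tree_aut m) : f [::] = [::].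
Proof.
case/lastP fr: (f [::]) => [//|w j]; exfalso.
have [fK fVK] := aut_invP f.
pose h o : vertex m := if o is Some i then rcons (rcons w j) i else w.
have h_inj : injective h.
  have ne i : rcons (rcons w j) i <> w.
    by move=> /(congr1 size); rewrite !size_rcons; lia.
  by case=> [i|] [i'|] //= => [/rcons_inj[->]|/ne|/esym/ne].
have h_edge o : tree_edge (f [::]) (h o).
  rewrite fr; apply/tree_edgeP.
  by case: o => [i|] /=; [left; exists i|right; exists j].
have gh o : {i | aut_inv f (h o) = [:: i]}.
  apply: cid; move: (h_edge o); rewrite -(fVK (h o)) aut_edge fVK.
  by move=> /tree_edgeP[[i ->]|[i]]; [exists i|case: (aut_inv _ _)].
pose k o := projT1 (gh o).
have k_inj : injective k.
  move=> o o' kk; apply: h_inj; apply: (can_inj fVK).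
  by rewrite (projT2 (gh o)) (projT2 (gh o')); congr [:: _].
by have := leq_card k k_inj; rewrite card_option !card_ord ltnn.
Qed.

Lemma aut_child (m : nat) (f : tree_aut m) v i :
  exists j, f (rcons v i) = rcons (f v) j.
Proof.
elim/last_ind: v i => [|v k IH] i.
  have : tree_edge (f [::]) (f (rcons [::] i)).
    by rewrite aut_edge; apply/tree_edgeP; left; exists i.
  by rewrite aut_root => /tree_edgeP[//|[j]]; case: (f _).
have [k' fvk] := IH k.
have : tree_edge (f (rcons v k)) (f (rcons (rcons v k) i)).
  by rewrite aut_edge; apply/tree_edgeP; left; exists i.
move=> /tree_edgeP[//|[j]]; rewrite fvk => /rcons_inj[/(bij_inj (aut_bij f))].
by move=> /(congr1 size); rewrite !size_rcons; lia.
Qed.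

Lemma aut_size (m : nat) (f : tree_aut m) v : size (f v) = size v.
Proof.
elim/last_ind: v => [|v i IH]; first by rewrite aut_root.
by have [j ->] := aut_child f v i; rewrite !size_rcons IH.
Qed.

Definition section_fun (m : nat) (f : tree_aut m) (v u : vertex m) : vertex m :=
  drop (size v) (f (v ++ u)).

Lemma section_funE (m : nat) (f : tree_aut m) v u :
  f (v ++ u) = f v ++ section_fun f v u.
Proof.
suff [w fvu] : exists w, f (v ++ u) = f v ++ w.
  by rewrite /section_fun fvu -(aut_size f v) drop_size_cat.
elim/last_ind: u => [|u i [w IH]]; first by exists [::]; rewrite !cats0.
have [j] := aut_child f (v ++ u) i.
by rewrite rcons_cat IH rcons_cat => ->; exists (rcons w j).
Qed.

Fact section_bij (m : nat) (f : tree_aut m) v : bijective (section_fun f v).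
Proof.
have [fK fVK] := aut_invP f.
exists (fun u => drop (size v) (aut_inv f (f v ++ u))) => u.
  by rewrite -section_funE fK drop_size_cat.
have [w fw] : exists w, aut_inv f (f v ++ u) = v ++ w.
  by exists (section_fun (aut_inv f) (f v) u); rewrite section_funE fK.
rewrite fw drop_size_cat // /section_fun -fw fVK.
by rewrite -(aut_size f v) drop_size_cat.
Qed.

Fact section_edge (m : nat) (f : tree_aut m) v u w :
  tree_edge (section_fun f v u) (section_fun f v w) = tree_edge u w.
Proof.
by rewrite -(tree_edge_cat (f v)) -!section_funE aut_edge tree_edge_cat.
Qed.

Definition section (m : nat) (f : tree_aut m) (v : vertex m) : tree_aut m :=
  TreeAut (section_bij f v) (section_edge f v).

Lemma sectionP (m : nat) (f : tree_aut m) (v : vertex m) :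
  (forall u, f (v ++ u) = f v ++ section f v u) /\
  (forall g : tree_aut m,
    (forall u, f (v ++ u) = f v ++ g u) -> g = section f v).
Proof.
split=> [u|g fg]; first exact: section_funE.
apply: aut_eqP => u; have := fg u.
by rewrite section_funE => /eqP; rewrite eqseq_cat // eqxx => /eqP.
Qed.

Definition sigma_fun (m : nat) (f : tree_aut m) (i : 'I_m) : 'I_m :=
  head i (f [:: i]).

Lemma sigma_funE (m : nat) (f : tree_aut m) i : f [:: i] = [:: sigma_fun f i].
Proof.
by rewrite /sigma_fun; have := aut_size f [:: i]; case: (f _) => [|j []].
Qed.

Fact sigma_inj (m : nat) (f : tree_aut m) : injective (sigma_fun f).
Proof.
move=> i j ij; suff [] : [:: i] = [:: j] by [].
by apply: (bij_inj (aut_bij f)); rewrite !sigma_funE ij.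
Qed.

Definition sigma (m : nat) (f : tree_aut m) : 'S_m := perm (@sigma_inj m f).

Definition psi (m : nat) (f : tree_aut m) : {ffun 'I_m -> tree_aut m} * 'S_m :=
  ([ffun i => section f [:: i]], sigma f).

Definition level_stab (m n : nat) : set (tree_aut m) :=
  [set f | forall v : vertex m, size v = n -> f v = v].

Definition stab (m : nat) (G : set (tree_aut m)) (n : nat) : set (tree_aut m) :=
  G `&` level_stab n.

(* Subgroups of the infinite group tree_aut m are sets, as {group _}
   requires a finGroupType. *)
Definition is_subgroup (m : nat) (G : set (tree_aut m)) : Prop :=
  group_closed [in G].

Definition cosets (m : nat) (G K : set (tree_aut m)) : set (set (tree_aut m)) :=
  (fun g => (fun k => (k * g)%g) @` K) @` G.

(* |G : K|; the value is 0 when the index is infinite. *)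
Definition subgroup_index (m : nat) (G K : set (tree_aut m)) : nat :=
  #|` fset_set (cosets G K)|.

Definition congruence_quotient (m : nat) (G : set (tree_aut m)) (n : nat) :
  set (set (tree_aut m)) := cosets G (stab G n).

Definition quotient_order (m : nat) (G : set (tree_aut m)) (n : nat) : nat :=
  #|` fset_set (congruence_quotient G n)|.

Definition self_similar (m : nat) (G : set (tree_aut m)) : Prop :=
  forall g v, G g -> G (section g v).

Definition level_transitive (m : nat) (G : set (tree_aut m)) : Prop :=
  forall u v : vertex m, size u = size v -> exists2 g, G g & g u = v.

(* Through psi, the direct power K x ... x K is the set of the pairs (k, 1). *)
Definition branching (m : nat) (K : set (tree_aut m)) : Prop :=
  [set x : {ffun 'I_m -> tree_aut m} * 'S_m |
    (forall i, K (x.1 i)) /\ x.2 = 1%g] `<=` @psi m @` K.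

Definition regular_branch_over (m : nat) (G K : set (tree_aut m)) : Prop :=
  [/\ is_subgroup G, self_similar G & level_transitive G] /\
  [/\ is_subgroup K, K `<=` G, finite_set (cosets G K) & branching K].

Definition wreath (m : nat) (H : {group 'S_m}) : set (tree_aut m) :=
  [set f | forall v, sigma (section f v) \in H].

(* The neighbourhoods in the congruence topology, in which the level_stab n,
   n >= 1, form a base of open neighbourhoods of 1. *)
Definition aut_nbhs (m : nat) (f : tree_aut m) : set_system (tree_aut m) :=
  [set A | exists2 n, (0 < n)%N & (fun g => (f * g)%g) @` level_stab n `<=` A].

HB.instance Definition _ (m : nat) := hasNbhs.Build (tree_aut m) (@aut_nbhs m).

Lemma level_stab1 (m n : nat) : level_stab n (1%g : tree_aut m).
Proof. by []. Qed.

Lemma level_stabM (m n : nat) (f g : tree_aut m) :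
  level_stab n f -> level_stab n g -> level_stab n (f * g)%g.
Proof. by move=> fn gn v vn /=; rewrite fn ?gn. Qed.

Lemma level_stab_le (m n p : nat) :
  (n <= p)%N -> @level_stab m p `<=` level_stab n.
Proof.
move=> np f fp [|i v] vn; first exact: aut_root.
have := fp ((i :: v) ++ nseq (p - n) i).
rewrite size_cat size_nseq vn subnKC // => /(_ erefl).
by rewrite section_funE => /eqP; rewrite eqseq_cat ?aut_size // => /andP[/eqP].
Qed.

Fact aut_nbhs_filter (m : nat) (f : tree_aut m) : ProperFilter (nbhs f).
Proof.
split; first by move=> [n _]; apply; exists 1%g; [exact: level_stab1|].
split.
- by exists 1%N.
- move=> A B [n n0 fA] [p p0 fB]; exists (maxn n p) => [|_ [g gnp <-]].
    by rewrite leq_max n0.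
  split; [apply: fA|apply: fB]; exists g => //.
    exact: level_stab_le (leq_maxl n p) _ gnp.
  exact: level_stab_le (leq_maxr n p) _ gnp.
- by move=> A B AB [n n0 fA]; exists n => //; exact: subset_trans AB.
Qed.

Fact aut_nbhs_singleton (m : nat) (f : tree_aut m) (A : set (tree_aut m)) :
  nbhs f A -> A f.
Proof.
by move=> [n _ fA]; apply: fA; exists 1%g; [exact: level_stab1|rewrite mulg1].
Qed.

Fact aut_nbhs_nbhs (m : nat) (f : tree_aut m) (A : set (tree_aut m)) :
  nbhs f A -> nbhs f (nbhs^~ A).
Proof.
move=> [n n0 fA]; exists n => // _ [g gn <-]; exists n => // _ [h hn <-].
by apply: fA; exists (g * h)%g; [exact: level_stabM|rewrite mulgA].
Qed.

HB.instance Definition _ (m : nat) := Nbhs_isNbhsTopological.Build (tree_aut m)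
  (@aut_nbhs_filter m) (@aut_nbhs_singleton m) (@aut_nbhs_nbhs m).

(* Hence the closure in W_H of a subset of W_H is its closure in Aut T_m. *)
Lemma wreath_closed (m : nat) (H : {group 'S_m}) : closed (wreath H).
Proof.
move=> f fcl v.
have [|_ [/[swap] [[g gv <-]] Wh]] :=
  fcl ((fun g => (f * g)%g) @` level_stab (size v).+1).
  by exists (size v).+1.
suff -> : sigma (section f v) = sigma (section (f * g)%g v) by exact: Wh.
apply/permP => i; rewrite !permE /sigma_fun /= /section_fun /=.
by rewrite gv // aut_size size_cat addn1.
Qed.

Local Open Scope ring_scope.

Definition log_base (R : realType) (m k : nat) : R := ln k%:R / ln m%:R.

Definition hdim (R : realType) (m : nat) (H : {group 'S_m})
    (G : set (tree_aut m)) : R :=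
  limn_inf (fun n =>
    log_base R m (subgroup_index G (stab G n)) /
    log_base R m (subgroup_index (wreath H) (stab (wreath H) n))).

Definition Omega (n : nat) : nat := \sum_(p <- primes n) logn p n.

(* Meaningful for n >= 1 only. *)
Definition s_level (R : realType) (m : nat) (G : set (tree_aut m))
    (n : nat) : R :=
  m%:R * log_base R m (subgroup_index (stab G n.-1) (stab G n)) -
  log_base R m (subgroup_index (stab G n) (stab G n.+1)).

(* Main.v *)
Require Import Defs.
From mathcomp Require Import all_boot all_order all_algebra all_fingroup.
From mathcomp Require Import finmap zify ring.
From mathcomp Require Import all_classical all_reals all_analysis.

Import Order.TTheory GRing.Theory Num.Theory.

Import numFieldNormedType.Exports.

Local Open Scope classical_set_scope.
Local Open Scope ring_scope.

(** Let [w = Omega |G : K|] and call two automorphisms alike on level [n] when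
    they move the vertices of that level in the same way. Everything rests on
    the subgroups [M_n = K St_G(n)] of the elements of [G] that are alike on
    level [n] to some element of [K].

    Once [M_n = M_(n+1)], the chain [M_0 >= M_1 >= ...] is constant from [n]
    on. Indeed the equality says that [St_G(n)] is contained in [M_(n+1)]. An
    element [g] of [St_G(n+1)] has its first-level sections in [St_G(n)], so
    they are alike on level [n+1] to elements [k_1, ..., k_m] of [K]; as [K] is
    branching, [(k_1, ..., k_m)] lies in [K], and it is alike to [g] on level
    [n+2] ([stab_approxS]). On the other hand every [|G : M_n|] divides
    [|G : K|], and each strict step of the chain costs a prime factor, so a step
    that is not strict occurs at some [n <= w] ([approx_stationary]). Hence
    [St_G(w)] is contained in every [M_n], that is, in the closure of [K]
    ([stab_Omega_approx]).

    Consequently any [m]-tuple of elements of [St_G(w)] is alike, on any given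
    level, to the tuple of sections of an element of [G] fixing the first level
    ([stab_Omega_glue]). Passing to the limit, the level stabilizer of the
    closure is branching ([closure_regular_branch]); counting, [St_G(n+1)]
    modulo [St_G(n+2)] is the [m]-th power of [St_G(n)] modulo [St_G(n+1)] for
    [n >= w] ([index_stab_branch]), which means that [s_n(G) = 0] for [n > w].

    With [a_n = log |St_G(n) : St_G(n+1)|] the definition of [s_n] reads
    [a_n = m a_(n-1) - s_n], a linear recurrence with vanishing right-hand side
    from [w] on. Solving it gives [log |G_n|] as an affine function of [m^n].
    Since [|W_(n+1)| = |H| |W_n|^m] ([index_wreathS]), the denominator of the
    Hausdorff dimension is [log |H| (m^n - 1) / (m - 1)], and the quotient
    converges to the stated value. *)

(** * Subgroups and their indices *)

Lemma subgroupP {m} (A : set (tree_aut m)) :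
  is_subgroup A <-> A 1%g /\ forall x y, A x -> A y -> A (x * y^-1)%g.
Proof.
split=> [[A1 AB]|[A1 AB]].
  split=> [|x y Ax Ay]; first by move: A1; rewrite inE.
  by have := AB x y (mem_set Ax) (mem_set Ay); rewrite inE.
split=> [|x y]; first exact: mem_set.
by move=> /set_mem Ax /set_mem Ay; apply: mem_set; exact: AB.
Qed.

Lemma subgroupV {m} {A : set (tree_aut m)} {x} :
  is_subgroup A -> A x -> A x^-1%g.
Proof. by move=> /subgroupP[A1 AB] /(AB _ _ A1); rewrite mul1g. Qed.

Lemma subgroupM {m} {A : set (tree_aut m)} {x y} :
  is_subgroup A -> A x -> A y -> A (x * y)%g.
Proof.
move=> sA Ax /(subgroupV sA) Ay.
by have /subgroupP[_ /(_ _ _ Ax Ay)] := sA; rewrite invgK.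
Qed.

Definition coset_by {m} (A : set (tree_aut m)) (g : tree_aut m) :=
  (fun k => (k * g)%g) @` A.

Lemma mem_coset_by {m} (A : set (tree_aut m)) g x :
  coset_by A g x <-> A (x * g^-1)%g.
Proof.
split=> [[k Ak <-]|Ax]; first by rewrite mulgK.
by exists (x * g^-1)%g => //; rewrite mulgKV.
Qed.

Lemma eq_coset_by {m} (A : set (tree_aut m)) x y :
  is_subgroup A -> coset_by A x = coset_by A y <-> A (x * y^-1)%g.
Proof.
move=> sA; have [A1 _] := (subgroupP A).1 sA; split=> [xy|Axy].
  by apply/mem_coset_by; rewrite -xy; apply/mem_coset_by; rewrite mulgV.
apply/seteqP; split=> z /mem_coset_by Az; apply/mem_coset_by.
  by have := subgroupM sA Az Axy; rewrite mulgA mulgKV.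
have := subgroupM sA Az (subgroupV sA Axy).
by rewrite invgM invgK mulgA mulgKV.
Qed.

(** Every index below is computed by this lemma: it replaces the set of
    cosets by the image of any map whose fibres are the cosets, and that image
    can be chosen so that its cardinality is plain. *)
Lemma index_image {m} {T : choiceType} (phi : tree_aut m -> T)
    (A B : set (tree_aut m)) :
  is_subgroup B ->
  (forall x y, A x -> A y -> phi x = phi y <-> B (x * y^-1)%g) ->
  finite_set (phi @` A) ->
  finite_set (cosets A B) /\ subgroup_index A B = #|` fset_set (phi @` A)|.
Proof.
move=> sB phiP phifin.
(* the coset of any element of A in the fibre over t *)
pose h t := coset_by B (xget 1%g [set x | A x /\ phi x = t]).
have hP x : A x -> h (phi x) = coset_by B x.
  move=> Ax; apply/eq_coset_by => //.
  have [Ay pxy] : [set y | A y /\ phi y = phi x]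
      (xget 1%g [set y | A y /\ phi y = phi x]) by exact: (@xgetI _ 1%g _ x).
  exact/phiP.
have cosetsE : cosets A B = h @` (phi @` A).
  apply/seteqP; split=> [_ [x Ax <-]|_ [_ [x Ax <-] <-]].
    by exists (phi x); [exists x|exact: hP].
  by rewrite hP //; exists x.
have hinj : {in phi @` A &, injective h}.
  move=> _ _ /set_mem[x Ax <-] /set_mem[y Ay <-].
  by rewrite !hP // => /eq_coset_by xy; apply/phiP => //; exact: xy.
have hfin : finite_set (h @` (phi @` A)) by exact: finite_image.
rewrite /subgroup_index cosetsE; split => //.
by apply/fcard_eq => //; exact: inj_card_eq hinj.
Qed.

Lemma index_image_fin {m} {T : finType} (phi : tree_aut m -> T)
    (A B : set (tree_aut m)) (S : {pred T}) :
  is_subgroup B ->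
  (forall x y, A x -> A y -> phi x = phi y <-> B (x * y^-1)%g) ->
  (forall t, t \in S <-> exists2 x, A x & phi x = t) ->
  finite_set (cosets A B) /\ subgroup_index A B = #|S|.
Proof.
move=> sB phiP SP; have imE : phi @` A = [set` [fset t in S]%fset].
  by apply/seteqP; split=> t; rewrite /= !inE => /SP.
have [|? ->] := @index_image _ _ phi _ _ sB phiP; first by rewrite imE.
by split=> //; rewrite imE set_fsetK card_finset.
Qed.

Lemma index_gt0 {m} (A B : set (tree_aut m)) :
  finite_set (cosets A B) -> A 1%g -> (0 < subgroup_index A B)%N.
Proof.
move=> fin A1; rewrite cardfs_gt0; apply/fset0Pn; exists (coset_by B 1%g).
by rewrite in_fset_set //; apply: mem_set; exists 1%g.
Qed.

Lemma index_eq1 {m} {A B : set (tree_aut m)} :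
  is_subgroup A -> is_subgroup B -> finite_set (cosets A B) ->
  subgroup_index A B = 1%N -> A `<=` B.
Proof.
move=> /subgroupP[A1 _] sB fin /eqP/cardfs1P[C] ABC x Ax.
have inC y : A y -> coset_by B y = C.
  move=> Ay; apply/eqP; rewrite -in_fset1 -ABC in_fset_set //.
  by apply: mem_set; exists y.
have /eq_coset_by := etrans (inC x Ax) (esym (inC _ A1)).
by rewrite invg1 mulg1; exact.
Qed.

Lemma cosets_sub {m} {A A' B : set (tree_aut m)} :
  A' `<=` A -> cosets A' B `<=` cosets A B.
Proof. by move=> A'A _ [x /A'A Ax <-]; exists x. Qed.

Lemma finite_cosets_sup {m} {A B C : set (tree_aut m)} :
  is_subgroup B -> is_subgroup C -> C `<=` B ->
  finite_set (cosets A C) -> finite_set (cosets A B).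
Proof.
move=> sB sC CB.
move=> /(finite_image (fun D => [set z | exists2 c, D c & coset_by B c z])).
apply: sub_finite_set => _ [x Ax <-].
exists (coset_by C x); first by exists x.
have [C1 _] := (subgroupP C).1 sC.
apply/seteqP; split=> [z [c /mem_coset_by /CB cx] zc|z zx].
  have /eq_coset_by : B (c * x^-1)%g by [].
  by move=> /(_ sB) cxE; move: zc; rewrite cxE.
by exists x => //; apply/mem_coset_by; rewrite mulgV.
Qed.

Lemma card_fset_setX {T T' : choiceType} (A : set T) (B : set T') :
  finite_set A -> finite_set B ->
  #|` fset_set (A `*` B)| = (#|` fset_set A| * #|` fset_set B|)%N.
Proof.
move=> fA fB; rewrite fset_setX //; set a := fset_set A; set b := fset_set B.
have -> : (a `*` b)%fset = [fset (val p.1, val p.2) | p in {: a * b}]%fset.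
  apply/fsetP => -[x y]; rewrite in_fsetM /=; apply/andP/imfsetP => [[xa yb]|].
    by exists ([` xa]%fset, [` yb]%fset).
  by move=> [[x' y'] _ /= [-> ->]]; split; exact: fsvalP.
rewrite card_imfset /=; last by move=> [? ?] [? ?] /= [/val_inj-> /val_inj->].
by rewrite -cardE card_prod !cardfE.
Qed.

(** An element [g] of [A] is determined by its coset modulo [B] together with
    its displacement modulo [C] from a chosen representative of that coset. *)
Lemma index_tower {m} {A B C : set (tree_aut m)} :
  is_subgroup A -> is_subgroup B -> is_subgroup C -> C `<=` B -> B `<=` A ->
  finite_set (cosets A B) -> finite_set (cosets B C) ->
  finite_set (cosets A C) /\
  subgroup_index A C = (subgroup_index A B * subgroup_index B C)%N.
Proof.
move=> sA sB sC CB BA fAB fBC; have [B1 _] := (subgroupP B).1 sB.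
pose r x := xget 1%g (coset_by B x).
have rP x : B (x * (r x)^-1)%g.
  have : coset_by B x (r x).
    by apply: (@xgetI _ 1%g _ x); apply/mem_coset_by; rewrite mulgV.
  by move=> /mem_coset_by/(subgroupV sB); rewrite invgM invgK.
have rE x y : coset_by B x = coset_by B y -> r x = r y by rewrite /r => ->.
pose phi x := (coset_by B x, coset_by C (x * (r x)^-1)%g).
have phiA : phi @` A = cosets A B `*` cosets B C.
  apply/seteqP; split=> [_ [x Ax <-]|[_ _] [/= [x Ax <-] [y By <-]]].
    by split; [exists x|exists (x * (r x)^-1)%g].
  have Bry : B (y * r x * x^-1)%g.
    have := subgroupM sB By (subgroupV sB (rP x)).
    by rewrite invgM invgK mulgA.
  have yx : coset_by B (y * r x)%g = coset_by B x by exact/eq_coset_by.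
  exists (y * r x)%g; last by rewrite /phi (rE _ _ yx) mulgK yx.
  by have := subgroupM sA (BA _ Bry) Ax; rewrite mulgKV.
have phiP x y : A x -> A y -> phi x = phi y <-> C (x * y^-1)%g.
  have E t : (x * t^-1 * (y * t^-1)^-1 = x * y^-1)%g.
    by rewrite invgM invgK mulgA mulgKV.
  move=> Ax Ay; split=> [[/rE rxy]|Cxy].
    by rewrite -rxy => /eq_coset_by; rewrite E; exact.
  have xy : coset_by B x = coset_by B y by apply/eq_coset_by => //; exact: CB.
  by rewrite /phi -(rE _ _ xy) xy; congr (_, _); apply/eq_coset_by; rewrite ?E.
have fin : finite_set (phi @` A) by rewrite phiA; exact: finite_setX.
have [? ->] := index_image phi _ _ sC phiP fin.
by rewrite phiA card_fset_setX.
Qed.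

(** * Acting alike on a level *)

Definition agree {m} (n : nat) (f g : tree_aut m) :=
  forall v : vertex m, size v = n -> f v = g v.

Lemma level_stab_agree {m} n (f g : tree_aut m) :
  level_stab n (f * g^-1)%g <-> agree n f g.
Proof.
have [gK gVK] := aut_invP g.
split=> fg v vn; last by rewrite -[RHS](gK v) -(fg v vn).
by rewrite -[LHS]gVK; congr (g _); exact: fg.
Qed.

Lemma agree_sym {m} n (f g : tree_aut m) : agree n f g -> agree n g f.
Proof. by move=> fg v vn; rewrite fg. Qed.

Lemma agree_trans {m} n (g f h : tree_aut m) :
  agree n f g -> agree n g h -> agree n f h.
Proof. by move=> fg gh v vn; rewrite fg ?gh. Qed.

Lemma agree0 {m} (f g : tree_aut m) : agree 0 f g.
Proof. by move=> v /size0nil ->; rewrite !aut_root. Qed.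

Lemma agree_le {m} {n p} {f g : tree_aut m} :
  (n <= p)%N -> agree p f g -> agree n f g.
Proof.
by move=> np /level_stab_agree /(level_stab_le np) /level_stab_agree.
Qed.

Lemma agreeM {m} n (f f' g g' : tree_aut m) :
  agree n f f' -> agree n g g' -> agree n (f * g)%g (f' * g')%g.
Proof. by move=> ff gg v vn /=; rewrite ff // gg // aut_size. Qed.

Lemma agreeV {m} n (f g : tree_aut m) : agree n f g -> agree n f^-1%g g^-1%g.
Proof.
move=> fg v vn; have [_ fVK] := aut_invP f; have [gK _] := aut_invP g.
by rewrite -[RHS](congr1 _ (fVK v)) fg ?gK // aut_size.
Qed.

Lemma agreeB {m} n (f f' g g' : tree_aut m) :
  agree n f f' -> agree n g g' -> agree n (f * g^-1)%g (f' * g'^-1)%g.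
Proof. by move=> ff /agreeV; exact: agreeM. Qed.

Lemma level_stabE {m} n (f : tree_aut m) : level_stab n f <-> agree n f 1%g.
Proof. by split=> fn v vn; rewrite fn. Qed.

Lemma subgroup_stab {m} (A : set (tree_aut m)) n :
  is_subgroup A -> is_subgroup (stab A n).
Proof.
move=> /subgroupP[A1 AB]; apply/subgroupP; split=> [//|x y].
move=> [Ax /level_stabE xn] [Ay /level_stabE yn]; split; first exact: AB.
by apply/level_stab_agree; apply: agree_trans xn _; exact: agree_sym.
Qed.

Lemma stab_sub {m} (A : set (tree_aut m)) n : stab A n `<=` A.
Proof. by move=> x []. Qed.

Lemma stab_le {m} (A : set (tree_aut m)) n p :
  (n <= p)%N -> stab A p `<=` stab A n.
Proof. by move=> np x [Ax /(level_stab_le np)]. Qed.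

Lemma stab0 {m} (A : set (tree_aut m)) : stab A 0 = A.
Proof.
apply/seteqP; split=> [|x Ax]; first exact: stab_sub.
by split=> //; apply/level_stabE; exact: agree0.
Qed.

Lemma stab_div {m} (A : set (tree_aut m)) n x y :
  is_subgroup A -> A x -> A y -> agree n x y <-> stab A n (x * y^-1)%g.
Proof.
move=> /subgroupP[_ AB] Ax Ay; split=> [xy|[_ /level_stab_agree//]].
by split; [exact: AB|apply/level_stab_agree].
Qed.

(** Its values lie in a finite type, so that the index of a level stabilizer
    becomes the cardinality of a finite set. *)
Definition level_action {m} n (f : tree_aut m) :
    {ffun n.-tuple 'I_m -> n.-tuple 'I_m} :=
  [ffun t : n.-tuple 'I_m => insubd t (f t)].

Lemma level_actionP {m} n (f g : tree_aut m) :
  level_action n f = level_action n g <-> agree n f g.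
Proof.
have E h (t : n.-tuple 'I_m) : val (level_action n h t) = h t.
  by rewrite ffunE insubdK // -topredE /= aut_size size_tuple.
split=> [fg v /eqP vn|fg]; first by have := E f (Tuple vn); rewrite fg E.
by apply/ffunP => t; apply: val_inj; rewrite !E fg // size_tuple.
Qed.

Definition level_image {m} n (A : set (tree_aut m)) :=
  [set t | `[< exists2 f, A f & level_action n f = t >]]%SET.

Lemma mem_level_image {m} n (A : set (tree_aut m)) t :
  t \in level_image n A <-> exists2 f, A f & level_action n f = t.
Proof. by rewrite inE; split=> [/asboolP|/asboolP]. Qed.

Lemma index_stab {m} (A X : set (tree_aut m)) n :
  is_subgroup A -> X `<=` A ->
  finite_set (cosets X (stab A n)) /\
  subgroup_index X (stab A n) = #|level_image n X|.
Proof.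
move=> sA XA; apply: (index_image_fin (level_action n)).
- exact: subgroup_stab.
- by move=> x y /XA Ax /XA Ay; rewrite level_actionP; exact: stab_div.
- exact: mem_level_image.
Qed.

Lemma index_stabS {m} (A : set (tree_aut m)) n :
  is_subgroup A ->
  subgroup_index A (stab A n.+1) =
    (subgroup_index A (stab A n) *
     subgroup_index (stab A n) (stab A n.+1))%N.
Proof.
move=> sA; have sAn k := subgroup_stab A k sA.
have [fn _] := index_stab A A n sA (fun _ => id).
have [fS _] := index_stab A _ n.+1 sA (stab_sub A n).
by have [] := index_tower sA (sAn n) (sAn n.+1) (stab_le A _ _ (leqnSn n))
                          (stab_sub A n) fn fS.
Qed.

Lemma index_stab_gt0 {m} (A : set (tree_aut m)) n p :
  is_subgroup A -> (0 < subgroup_index (stab A n) (stab A p))%N.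
Proof.
move=> sA; have [fin _] := index_stab A _ p sA (stab_sub A n).
by apply: index_gt0 => //; have /subgroupP[] := subgroup_stab A n sA.
Qed.

(** * Automorphisms from their first-level sections *)

Lemma aut_cons {m} (f : tree_aut m) i u :
  f (i :: u) = sigma f i :: section f [:: i] u.
Proof. by rewrite -cat1s section_funE sigma_funE permE. Qed.

Lemma agreeS {m} n (f g : tree_aut m) :
  agree n.+1 f g <->
  sigma f = sigma g /\ forall i, agree n (section f [:: i]) (section g [:: i]).
Proof.
split=> [fg|[fg1 fg] [//|i v] [vn]]; last by rewrite !aut_cons fg1 fg.
have fgc i v : size v = n -> f (i :: v) = g (i :: v).
  by move=> vn; apply: fg; rewrite /= vn.
split=> [|i v /(fgc i)]; last by rewrite !aut_cons => -[].
apply/permP => i; have := fgc i (nseq n i).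
by rewrite size_nseq !aut_cons => /(_ erefl)[].
Qed.

Lemma section_nil {m} (f : tree_aut m) : section f [::] = f.
Proof. by symmetry; apply: (sectionP f [::]).2 => u; rewrite aut_root. Qed.

Lemma section_cons {m} (f : tree_aut m) i v :
  section f (i :: v) = section (section f [:: i]) v.
Proof.
symmetry; apply: (sectionP _ _).2 => u.
by rewrite !aut_cons (section_funE (section f [:: i])).
Qed.

Lemma sectionM {m} (f g : tree_aut m) v :
  section (f * g)%g v = (section f v * section g (f v))%g.
Proof.
symmetry; apply: (sectionP _ _).2 => u.
by rewrite /= !section_funE.
Qed.

Lemma agree_section {m} n (f g : tree_aut m) v :
  agree (size v + n) f g -> agree n (section f v) (section g v).
Proof.
move=> fg u un; have := fg (v ++ u); rewrite size_cat un => /(_ erefl).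
have /(_ v erefl) fgv := agree_le (leq_addr n (size v)) fg.
by rewrite !section_funE fgv => /eqP; rewrite eqseq_cat // eqxx => /eqP.
Qed.

Lemma stab_section {m} (A : set (tree_aut m)) n x :
  self_similar A -> stab A n.+1 x ->
  sigma x = 1%g /\ forall i, stab A n (section x [:: i]).
Proof.
move=> ssA [Ax xn].
have xc j v : size v = n -> sigma x j :: section x [:: j] v = j :: v.
  by move=> vn; rewrite -aut_cons xn //= vn.
split; last by move=> i; split=> [|v vn]; [exact: ssA|have [] := xc i v vn].
apply/permP => j; have := xc j (nseq n j).
by rewrite size_nseq perm1 => /(_ erefl)[].
Qed.

Definition glue_fun {m} (g : 'I_m -> tree_aut m) (s : 'S_m) (v : vertex m) :
    vertex m :=
  if v is i :: u then s i :: g i u else [::].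

Lemma glue_bij {m} (g : 'I_m -> tree_aut m) (s : 'S_m) :
  bijective (glue_fun g s).
Proof.
exists (glue_fun (fun j => aut_inv (g (s^-1%g j))) s^-1%g) => -[//|i v] /=.
  by rewrite permK (aut_invP _).1.
by rewrite permKV (aut_invP _).2.
Qed.

Lemma tree_edge_sym {m} (u v : vertex m) : tree_edge u v = tree_edge v u.
Proof. exact: orbC. Qed.

Lemma tree_edge_nil {m} (v : vertex m) : tree_edge [::] v = (size v == 1%N).
Proof.
apply/tree_edgeP/idP => [[] [i]|]; [by move=> ->|by case: v|].
by case: v => [//|i [|//]] _; left; exists i.
Qed.

Lemma tree_edge_cons {m} i j (u v : vertex m) :
  tree_edge (i :: u) (j :: v) = (i == j) && tree_edge u v.
Proof.
apply/tree_edgeP/andP => [[] [k [-> ->]]|[/eqP <- /tree_edgeP[] [k ->]]].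
- by split=> //; apply/tree_edgeP; left; exists k.
- by split=> //; apply/tree_edgeP; right; exists k.
- by left; exists k.
- by right; exists k.
Qed.

Lemma glue_edge {m} (g : 'I_m -> tree_aut m) (s : 'S_m) u v :
  tree_edge (glue_fun g s u) (glue_fun g s v) = tree_edge u v.
Proof.
have sz w : size (glue_fun g s w) = size w.
  by case: w => //= i w; rewrite aut_size.
case: u => [|i u]; first by rewrite [glue_fun _ _ [::]]/= !tree_edge_nil sz.
case: v => [|j v].
  by rewrite ![tree_edge _ [::]]tree_edge_sym !tree_edge_nil sz.
rewrite /= !tree_edge_cons (inj_eq perm_inj).
by case: eqP => //= ->; rewrite aut_edge.
Qed.

(** The inverse of [psi]. *)
Definition glue {m} (g : 'I_m -> tree_aut m) (s : 'S_m) : tree_aut m :=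
  TreeAut (glue_bij g s) (glue_edge g s).

Lemma sigma_glue {m} (g : 'I_m -> tree_aut m) s : sigma (glue g s) = s.
Proof. by apply/permP => i; rewrite permE. Qed.

Lemma section_glue {m} (g : 'I_m -> tree_aut m) s i :
  section (glue g s) [:: i] = g i.
Proof. by symmetry; apply: (sectionP _ _).2 => u; rewrite /= aut_root. Qed.

Lemma branchingP {m} (A : set (tree_aut m)) :
  branching A <-> forall g, (forall i, A (g i)) -> A (glue g 1%g).
Proof.
split=> [brA g Ag|brA [g s] /= [Ag ->]].
  have [x Ax [xg x1]] : (@psi m @` A) ([ffun i => g i], 1%g).
    by apply: brA; split=> // i; rewrite ffunE.
  suff -> : glue g 1%g = x by [].
  apply: aut_eqP => -[|i v]; first by rewrite !aut_root.
  rewrite !aut_cons sigma_glue section_glue x1.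
  by have /ffunP/(_ i) := xg; rewrite !ffunE => ->.
exists (glue g 1%g); first exact: brA.
rewrite /psi sigma_glue; congr (_, _); apply/ffunP => i.
by rewrite ffunE section_glue.
Qed.

(** * Closures *)

Lemma closure_agree {m} (A : set (tree_aut m)) f :
  closure A f <-> forall n, exists2 g, A g & agree n f g.
Proof.
split=> [clf n|clf B [n _ fB]].
  have [|_ [/[swap] [[l ln <-]] Ag]] :=
    clf ((fun g => (f * g)%g) @` level_stab n.+1).
    by exists n.+1.
  exists (f * l)%g => // v vn /=.
  by rewrite (level_stab_le (leqnSn n) ln) // aut_size.
have [g Ag fg] := clf n; exists g; split => //; apply: fB.
exists (f^-1 * g)%g; last by rewrite mulgA mulgV mul1g.
move=> v vn; have [_ fVK] := aut_invP f.
by rewrite -[RHS]fVK [LHS]/= fg // aut_size.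
Qed.

Lemma sub_closure {m} (A : set (tree_aut m)) : A `<=` closure A.
Proof. by move=> x Ax; apply/closure_agree => n; exists x. Qed.

Lemma subgroup_closure {m} (A : set (tree_aut m)) :
  is_subgroup A -> is_subgroup (closure A).
Proof.
move=> /subgroupP[A1 AB]; apply/subgroupP; split; first exact: sub_closure.
move=> x y /closure_agree clx /closure_agree cly; apply/closure_agree => n.
have [x' Ax xx] := clx n; have [y' Ay yy] := cly n.
by exists (x' * y'^-1)%g; [exact: AB|exact: agreeB].
Qed.

Lemma self_similar_closure {m} (A : set (tree_aut m)) :
  self_similar A -> self_similar (closure A).
Proof.
move=> ssA g v /closure_agree clg; apply/closure_agree => n.
have [g' Ag gg] := clg (size v + n)%N.
by exists (section g' v); [exact: ssA|exact: agree_section].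
Qed.

Lemma level_transitive_sup {m} (A B : set (tree_aut m)) :
  A `<=` B -> level_transitive A -> level_transitive B.
Proof. by move=> AB trA u v /trA[g /AB Bg guv]; exists g. Qed.

(** A group and its closure act alike on each level. *)
Lemma index_stab_closure {m} (A : set (tree_aut m)) n :
  is_subgroup A ->
  subgroup_index (closure A) (stab (closure A) n) =
  subgroup_index A (stab A n).
Proof.
move=> sA; have [_ ->] := index_stab A A n sA (fun _ => id).
have [_ ->] := index_stab _ _ n (subgroup_closure A sA) (fun _ => id).
apply: eq_card => t; apply/idP/idP => /mem_level_image[f Af <-];
  apply/mem_level_image; last by exists f => //; exact: sub_closure.
have [g Ag fg] := (closure_agree A f).1 Af n.
by exists g => //; apply/level_actionP; exact: agree_sym.
Qed.

(** * Prime factors counted with multiplicity *)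

(** A range of summation independent of [n] makes the additivity of [Omega]
    termwise. *)
Lemma OmegaE n N : (0 < n < N)%N -> Omega n = (\sum_(p < N) logn p n)%N.
Proof.
move=> /andP[n0 nN].
have primesE : perm_eq (primes n) [seq p <- iota 0 N | p \in primes n].
  apply: uniq_perm => [||p]; rewrite ?primes_uniq ?filter_uniq ?iota_uniq //.
  rewrite mem_filter mem_iota /= andbC.
  case: (boolP (p \in primes n)); rewrite ?andbF // mem_primes andbT.
  by move=> /and3P[_ _ /(dvdn_leq n0)] pn; rewrite add0n (leq_ltn_trans pn nN).
rewrite /Omega (perm_big _ primesE) big_filter -(big_mkord predT (logn^~ n)).
rewrite big_mkcond /index_iota subn0; apply: eq_bigr => p _.
by case: ifPn => //; rewrite -logn_gt0 lt0n negbK => /eqP.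
Qed.

Lemma OmegaM a b :
  (0 < a)%N -> (0 < b)%N -> Omega (a * b) = (Omega a + Omega b)%N.
Proof.
move=> a0 b0; have ab0 : (0 < a * b)%N by rewrite muln_gt0 a0.
(* any common bound of the three numbers *)
pose N := (a * b + a + b).+1.
rewrite !(@OmegaE _ N); try by rewrite ?a0 ?b0 ?ab0 /N ltnS; lia.
by rewrite -big_split; apply: eq_bigr => p _; exact: lognM.
Qed.

Lemma Omega_gt0 n : (1 < n)%N -> (0 < Omega n)%N.
Proof.
move=> n1; have pn : pdiv n \in primes n.
  by rewrite mem_primes pdiv_prime // pdiv_dvd (ltnW n1).
by rewrite /Omega (big_rem _ pn) /= addn_gt0 logn_gt0 pn.
Qed.

(** * Stabilizers inside a branching subgroup *)

(** The subgroup [K St_G(n)]. *)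
Definition approx {m} (G K : set (tree_aut m)) n :=
  [set g | G g /\ exists2 k, K k & agree n g k].

Lemma subgroup_approx {m} (G K : set (tree_aut m)) n :
  is_subgroup G -> is_subgroup K -> is_subgroup (approx G K n).
Proof.
move=> /subgroupP[G1 GB] /subgroupP[K1 KB]; apply/subgroupP; split.
  by split=> //; exists 1%g.
move=> x y [Gx [k Kk xk]] [Gy [l Kl yl]]; split; first exact: GB.
by exists (k * l^-1)%g; [exact: KB|exact: agreeB].
Qed.

Lemma approx_sub {m} (G K : set (tree_aut m)) n : approx G K n `<=` G.
Proof. by move=> g []. Qed.

Lemma sub_approx {m} (G K : set (tree_aut m)) n :
  K `<=` G -> K `<=` approx G K n.
Proof. by move=> KG k Kk; split; [exact: KG|exists k]. Qed.

Lemma approx_le {m} (G K : set (tree_aut m)) n p :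
  (n <= p)%N -> approx G K p `<=` approx G K n.
Proof.
by move=> np g [Gg [k Kk gk]]; split=> //; exists k => //; exact: agree_le gk.
Qed.

Lemma stab_sub_approx {m} (G K : set (tree_aut m)) n :
  is_subgroup K -> stab G n `<=` approx G K n.
Proof.
by move=> /subgroupP[K1 _] g [Gg /level_stabE gn]; split=> //; exists 1%g.
Qed.

(** Divide by an element of [K] alike on level [n]: what remains is in
    [St_G(n)]. Thus [M_n = M_(n+1)] can be tested on [St_G(n)] alone. *)
Lemma approx_subS {m} (G K : set (tree_aut m)) n :
  is_subgroup G -> is_subgroup K -> K `<=` G ->
  stab G n `<=` approx G K n.+1 -> approx G K n `<=` approx G K n.+1.
Proof.
move=> sG sK KG Gn g [Gg [k Kk gk]]; split=> //.
have /Gn[_ [l Kl gkl]] : stab G n (g * k^-1)%g.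
  by apply/(stab_div G n g k sG Gg (KG _ Kk)).
exists (l * k)%g; first exact: subgroupM.
by rewrite -[g](mulgKV k); exact: agreeM.
Qed.

(** This is where branching enters: the first-level sections of an element of
    [St_G(n+1)] lie in [St_G(n)], and if each of them looks like an element of
    [K] down to level [p], then the element assembled from these elements is
    in [K] again and looks like the given one down to level [p+1]. *)
Lemma stab_approxS {m} (G K : set (tree_aut m)) n p :
  self_similar G -> branching K ->
  stab G n `<=` approx G K p -> stab G n.+1 `<=` approx G K p.+1.
Proof.
move=> ssG /branchingP brK GnK g gn; have [Gg _] := gn.
have /choice[k kP] i : exists k, K k /\ agree p (section g [:: i]) k.
  by have [_ /(_ i)/GnK[_ [k Kk gk]]] := stab_section G n g ssG gn; exists k.
split=> //; exists (glue k 1%g); first by apply: brK => i; have [] := kP i.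
apply/agreeS; rewrite sigma_glue; split=> [|i].
  have [-> _ //] := stab_section G n g ssG gn.
by rewrite section_glue; have [] := kP i.
Qed.

(** The indices [|G : K St_G(n)|] all divide [|G : K|], so they cannot grow
    at every one of the first [Omega |G : K| + 1] steps. *)
Lemma approx_stationary {m} (G K : set (tree_aut m)) :
  is_subgroup G -> is_subgroup K -> K `<=` G -> finite_set (cosets G K) ->
  exists2 n, (n <= Omega (subgroup_index G K))%N &
    stab G n `<=` approx G K n.+1.
Proof.
move=> sG sK KG fin; have sM n := subgroup_approx G K n sG sK.
have KM n := sub_approx G K n KG; have MG n := approx_sub G K n.
have [G1 _] := (subgroupP G).1 sG.
have M1 n : approx G K n 1%g by case: ((subgroupP _).1 (sM n)).
have fM n : finite_set (cosets G (approx G K n)).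
  exact: finite_cosets_sup (sM n) sK (KM n) fin.
have fMK n : finite_set (cosets (approx G K n) K).
  exact: sub_finite_set (cosets_sub (MG n)) fin.
have step n :
    approx G K n `<=` approx G K n.+1 -> stab G n `<=` approx G K n.+1.
  exact: subset_trans (stab_sub_approx G K n sK).
(* as long as the chain decreases strictly, each step adds a prime factor *)
have grow n : (exists2 i, (i < n)%N & stab G i `<=` approx G K i.+1) \/
              (n <= Omega (subgroup_index G (approx G K n)))%N.
  elim: n => [|n [[i im Gi]|IH]]; first by right.
    by left; exists i => //; exact: leqW.
  have MS := approx_le G K _ _ (leqnSn n).
  have fS : finite_set (cosets (approx G K n) (approx G K n.+1)).
    exact: sub_finite_set (cosets_sub (MG n)) (fM n.+1).
  have [_ ->] := index_tower sG (sM n) (sM n.+1) MS (MG n) (fM n) fS.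
  rewrite OmegaM ?index_gt0 //.
  have := index_gt0 _ _ fS (M1 n).
  case: (ltngtP 1 (subgroup_index (approx G K n) (approx G K n.+1))) => //.
    by move=> /Omega_gt0 O1 _; right; have := leq_add IH O1; rewrite addn1.
  by move=> /esym/(index_eq1 (sM n) (sM n.+1) fS)/step; left; exists n.
have [//|] := grow (Omega (subgroup_index G K)).+1.
set n := _.+1; have := index_tower sG (sM n) sK (KM n) (MG n) (fM n) (fMK n).
move=> [_ idx] big; suff : (n <= Omega (subgroup_index G K))%N by rewrite ltnn.
rewrite idx OmegaM ?index_gt0 //; exact: leq_trans big (leq_addr _ _).
Qed.

(** For all [n] together this says that [St_G(w)] lies in the closure of [K],
    where [w = Omega |G : K|]. *)
Lemma stab_Omega_approx {m} (G K : set (tree_aut m)) n :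
  regular_branch_over G K ->
  stab G (Omega (subgroup_index G K)) `<=` approx G K n.
Proof.
move=> [[sG ssG _] [sK KG fin brK]]; set w := Omega _.
have [i iw Gi] := approx_stationary G K sG sK KG fin.
(* once the chain is stationary at i, it is so at every later step *)
have Gj j : (i <= j)%N -> stab G j `<=` approx G K j.+1.
  move=> /subnK <-; elim: (j - i)%N => [//|d IH].
  by rewrite addSn; exact: stab_approxS.
elim: n => [|n IH].
  by move=> g [Gg _]; apply: (stab_sub_approx G K 0 sK); rewrite stab0.
have [nw|wn] := ltnP n w.
  exact: subset_trans (stab_le G _ _ nw) (stab_sub_approx G K n.+1 sK).
apply: subset_trans IH _; apply: approx_subS => //.
exact: Gj (leq_trans iw wn).
Qed.

(** Each prescribed section may be replaced by an element of [K] alike to it,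
    and elements of [K] can be glued together inside [G]. *)
Lemma stab_Omega_glue {m} (G K : set (tree_aut m)) n (g : 'I_m -> tree_aut m) :
  regular_branch_over G K ->
  (forall i, stab G (Omega (subgroup_index G K)) (g i)) ->
  exists2 x, G x & agree n.+1 (glue g 1%g) x.
Proof.
move=> rb Gg; have [[sG ssG _] [sK KG fin /branchingP brK]] := rb.
have /choice[k kP] i : exists k, K k /\ agree n (g i) k.
  by have /(stab_Omega_approx G K n rb)[_ [k Kk gk]] := Gg i; exists k.
exists (glue k 1%g); first by apply/KG/brK => i; have [] := kP i.
apply/agreeS; rewrite !sigma_glue; split=> // i.
by rewrite !section_glue; have [] := kP i.
Qed.

Lemma level_stab_glue {m} n (g : 'I_m -> tree_aut m) :
  (forall i, level_stab n (g i)) -> level_stab n.+1 (glue g 1%g).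
Proof. by move=> gn [//|i v] [vn] /=; rewrite perm1 gn. Qed.

Lemma closure_regular_branch {m} (G K : set (tree_aut m)) :
  regular_branch_over G K ->
  regular_branch_over (closure G)
    (stab (closure G) (Omega (subgroup_index G K))).
Proof.
move=> rb; have [[sG ssG trG] _] := rb; set w := Omega _.
have sC := subgroup_closure G sG.
split; split.
- exact: sC.
- exact: self_similar_closure.
- exact: level_transitive_sup (sub_closure G) trG.
- exact: subgroup_stab.
- exact: stab_sub.
- by have [] := index_stab _ _ w sC (fun _ => id).
apply/branchingP => g Cg; split; last first.
  apply: level_stab_le (leqnSn w) _ _.
  by apply: level_stab_glue => i; case: (Cg i).
apply/closure_agree => n.
(* elements of the closure are approximated deep enough to stay in the
   stabilizer of level w, where sections can be prescribed *)
have /choice[a aP] i : exists a, stab G w a /\ agree n (g i) a.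
  have [/closure_agree/(_ (maxn w n))[a Ga ga] /level_stabE gw] := Cg i.
  exists a; split; last exact: agree_le (leq_maxr w n) ga.
  split=> //; apply/level_stabE; apply: agree_trans gw.
  exact/agree_sym/(agree_le (leq_maxl w n)).
have [x Gx ax] := stab_Omega_glue G K n a rb (fun i => (aP i).1).
exists x => //; apply: agree_le (leqnSn n) _; apply: agree_trans ax.
apply/agreeS; rewrite !sigma_glue; split=> // i.
by rewrite !section_glue; have [] := aP i.
Qed.

(** * Orders of the successive quotients *)

(** Taking first-level sections embeds [St_G(n+1)] modulo [St_G(n+2)] into the
    [m]-th power of [St_G(n)] modulo [St_G(n+1)], for every [n]; from level [w]
    on, this is onto by [stab_Omega_glue]. *)
Lemma index_stab_branch {m} (G K : set (tree_aut m)) n :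
  regular_branch_over G K -> (Omega (subgroup_index G K) <= n)%N ->
  subgroup_index (stab G n.+1) (stab G n.+2) =
  (subgroup_index (stab G n) (stab G n.+1) ^ m)%N.
Proof.
move=> rb wn; have [[sG ssG _] _] := rb.
have [_ ->] := index_stab G _ n.+1 sG (stab_sub G n).
set I := level_image _ _.
pose phi (x : tree_aut m) := [ffun i => level_action n.+1 (section x [:: i])].
have [|x y Gx Gy|t|_ ->] := index_image_fin phi (stab G n.+1) (stab G n.+2)
    (ffun_on I).
- exact: subgroup_stab.
- have sg z := stab_section G n z ssG.
  rewrite -(stab_div G _ _ _ sG (stab_sub _ _ _ Gx) (stab_sub _ _ _ Gy)) agreeS.
  split=> [/ffunP xy|[_ xy]]; last first.
    by apply/ffunP => i; rewrite !ffunE; exact/level_actionP.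
  split=> [|i]; last by have := xy i; rewrite !ffunE => /level_actionP.
  by rewrite (sg _ Gx).1 (sg _ Gy).1.
- split=> [/ffun_onP tI|[x Gx <-]]; last first.
    apply/ffun_onP => i; rewrite ffunE; apply/mem_level_image.
    by exists (section x [:: i]) => //; have [] := stab_section G n x ssG Gx.
  have /choice[g gP] i : exists g, stab G n g /\ level_action n.+1 g = t i.
    by have /mem_level_image[g Gg gt] := tI i; exists g.
  have [x Gx gx] := stab_Omega_glue G K n.+1 g rb
    (fun i => stab_le G _ _ wn _ (gP i).1).
  exists x; last first.
    apply/ffunP => i; rewrite ffunE -(gP i).2; apply/level_actionP.
    by have /agreeS[_ /(_ i)] := gx; rewrite section_glue => /agree_sym.
  split=> //; apply/level_stabE; apply: agree_trans (agree_sym _ _ _ _) _.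
    exact: agree_le gx.
  by apply/level_stabE/level_stab_glue => i; have [[]] := gP i.
by rewrite card_ffun_on card_ord.
Qed.

Lemma sigmaM {m} (f g : tree_aut m) : sigma (f * g)%g = (sigma f * sigma g)%g.
Proof.
apply/permP => i; have := aut_cons (f * g)%g i [::].
by rewrite /= !aut_cons permM => -[->].
Qed.

Lemma sigma1 {m} : sigma (1%g : tree_aut m) = 1%g.
Proof. by apply/permP => i; rewrite !permE. Qed.

Lemma section1 {m} (v : vertex m) : section (1%g : tree_aut m) v = 1%g.
Proof. by symmetry; apply: (sectionP _ _).2. Qed.

Lemma subgroup_wreath {m} (H : {group 'S_m}) : is_subgroup (wreath H).
Proof.
apply/subgroupP; split=> [v|f g Hf Hg v].
  by rewrite section1 sigma1 group1.
rewrite sectionM sigmaM groupM //.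
(* the section of g^-1 at f v is the inverse of that of g at u *)
have [_ gK] := aut_invP g; pose u := aut_inv g (f v).
have := congr1 (@sigma m) (sectionM g g^-1%g u).
rewrite mulgV section1 sigma1 sigmaM gK => gu.
by rewrite -(mulKg (sigma (section g u)) (sigma _)) -gu mulg1 groupV.
Qed.

Lemma wreathP {m} (H : {group 'S_m}) f :
  wreath H f <-> sigma f \in H /\ forall i, wreath H (section f [:: i]).
Proof.
split=> [Hf|[Hs Hf] [|i v]]; last 2 first.
- by rewrite section_nil.
- by rewrite section_cons; exact: Hf.
split=> [|i v]; first by have := Hf [::]; rewrite section_nil.
by rewrite -section_cons; exact: Hf.
Qed.

(** The map [psi] identifies [W_H] with all of [W_H x ... x W_H] extended by
    [H], and level [n+1] of the tree with [m] copies of level [n]. *)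
Lemma index_wreathS {m} (H : {group 'S_m}) n :
  subgroup_index (wreath H) (stab (wreath H) n.+1) =
  (#|H| * subgroup_index (wreath H) (stab (wreath H) n) ^ m)%N.
Proof.
have sW := subgroup_wreath H.
have [_ ->] := index_stab _ _ n sW (fun _ => id); set I := level_image _ _.
pose phi (x : tree_aut m) :=
  (sigma x, [ffun i => level_action n (section x [:: i])]).
have [|x y Wx Wy|[s t]|_ ->] := index_image_fin phi (wreath H)
    (stab (wreath H) n.+1) [predX H & ffun_on I].
- exact: subgroup_stab.
- rewrite -(stab_div _ _ _ _ sW Wx Wy) agreeS.
  split=> [xy|[sxy xy]].
    have xy1 : sigma x = sigma y := congr1 fst xy.
    have /ffunP xy2 := congr1 snd xy; split=> // i.
    by have := xy2 i; rewrite !ffunE => /level_actionP.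
  rewrite /phi sxy; congr (_, _); apply/ffunP => i; rewrite !ffunE.
  exact/level_actionP.
- rewrite inE /=; split=> [/andP[Hs /ffun_onP tI]|[x /wreathP[Hx Wx] xst]].
    have /choice[g gP] i : exists g, wreath H g /\ level_action n g = t i.
      by have /mem_level_image[g Wg gt] := tI i; exists g.
    exists (glue g s).
      apply/wreathP; rewrite sigma_glue; split=> // i.
      by rewrite section_glue; have [] := gP i.
    rewrite /phi sigma_glue; congr (_, _); apply/ffunP => i.
    by rewrite ffunE section_glue; have [] := gP i.
  have <- : sigma x = s := congr1 fst xst; rewrite Hx.
  have /= <- := congr1 snd xst; apply/ffun_onP => i; rewrite ffunE.
  apply/mem_level_image.
  by exists (section x [:: i]).
by rewrite cardX card_ffun_on card_ord.
Qed.

Lemma index_stab0 {m} (A : set (tree_aut m)) :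
  is_subgroup A -> subgroup_index A (stab A 0) = 1%N.
Proof.
move=> sA; rewrite stab0; have /subgroupP[A1 AB] := sA.
have [//|x y Ax Ay|[]|_ ->] := index_image_fin (fun=> tt) A A predT.
- by split=> // _; exact: AB.
- by split=> // _; exists 1%g.
by rewrite card_unit.
Qed.

(** This keeps the denominator of the Hausdorff dimension from vanishing. *)
Lemma wreath_transitive_gt1 {m} (H : {group 'S_m}) (G : set (tree_aut m)) :
  (1 < m)%N -> G `<=` wreath H -> level_transitive G -> (1 < #|H|)%N.
Proof.
move=> m1 GW trG; pose i := Ordinal (ltnW m1); pose j := Ordinal m1.
have [g /GW/wreathP[Hs _] gij] := trG [:: i] [:: j] erefl.
rewrite cardG_gt1; apply/trivgPn; exists (sigma g) => //.
apply/eqP => s1; have := aut_cons g i [::].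
by rewrite gij s1 perm1 => -[].
Qed.

(** * Logarithms *)

Lemma log_baseM (R : realType) m a b : (0 < a)%N -> (0 < b)%N ->
  log_base R m (a * b) = log_base R m a + log_base R m b.
Proof.
by move=> a0 b0; rewrite /log_base natrM lnM ?posrE ?ltr0n // mulrDl.
Qed.

Lemma log_baseX (R : realType) m a k : (0 < a)%N ->
  log_base R m (a ^ k) = k%:R * log_base R m a.
Proof.
by move=> a0; rewrite /log_base natrX lnXn ?ltr0n // mulrA mulr_natl.
Qed.

Lemma log_base1 (R : realType) m : log_base R m 1 = 0.
Proof. by rewrite /log_base ln1 mul0r. Qed.

Lemma log_base_neq0 (R : realType) m a :
  (1 < m)%N -> (1 < a)%N -> log_base R m a != 0.
Proof.
by move=> m1 a1; rewrite /log_base mulf_neq0 ?invr_eq0 ?gt_eqF // ln_gt0 ?ltr1n.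
Qed.

(** * The recurrence and its limit *)

(** Dividing the recurrence by [q ^+ k] makes it telescope. *)
Lemma recurrence_term {F : fieldType} (q : F) (a s : nat -> F) n :
  q != 0 -> (forall k, s k.+1 = q * a k - a k.+1) ->
  a n = q ^+ n * (a 0 - \sum_(1 <= i < n.+1) s i / q ^+ i).
Proof.
move=> q0 sE; elim: n => [|n IH]; first by rewrite big_geq // subr0 mul1r.
rewrite big_nat_recr //= opprD addrA mulrBr exprS -mulrA -IH sE.
by rewrite mulrCA -exprS mulfV ?expf_neq0 // mulr1 opprB addrC subrK.
Qed.

(** Summing the recurrence expresses [L n], the sum of the first [n] terms of
    [a], through [a n]. *)
Lemma recurrence_sum {F : fieldType} (q : F) (a s L : nat -> F) n :
  (forall k, s k.+1 = q * a k - a k.+1) ->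
  L 0 = 0 -> (forall k, L k.+1 = L k + a k) ->
  (q - 1) * L n = a n - a 0 + \sum_(1 <= i < n.+1) s i.
Proof.
move=> sE L0 LS; elim: n => [|n IH].
  by rewrite big_geq // L0 mulr0 subrr addr0.
rewrite big_nat_recr //= LS mulrDr IH sE; ring.
Qed.

Lemma big_nat_cut {V : zmodType} (f : nat -> V) w n :
  (w <= n)%N -> (forall k, (w < k)%N -> f k = 0) ->
  \sum_(1 <= i < n.+1) f i = \sum_(1 <= i < w.+1) f i.
Proof.
move=> wn f0; rewrite (@big_cat_nat _ _ _ w.+1) //=.
rewrite [X in _ + X]big1_seq ?addr0 //.
by move=> i; rewrite mem_index_iota => /andP[_ /andP[/f0]].
Qed.

Lemma cvg_affine_exp_ratio (R : realType) (q a b c : R) (u : nat -> R) w :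
  1 < q -> c != 0 ->
  (forall n, (w <= n)%N -> u n = (a * q ^+ n + b) / (c * (q ^+ n - 1))) ->
  u @ \oo --> a / c.
Proof.
move=> q1 c0 uE; have q0 : q != 0 by rewrite gt_eqF // (lt_trans ltr01).
have qV : (fun n => q^-1 ^+ n) @ \oo --> (0 : R).
  apply: cvg_expr; rewrite ger0_norm ?invr_ge0 ?(ltW (lt_trans ltr01 q1)) //.
  by rewrite invf_lt1 // (lt_trans ltr01).
(* both numerator and denominator are divided by q ^+ n *)
have lim :
    (fun n => (a + b * q^-1 ^+ n) / (c * (1 - q^-1 ^+ n))) @ \oo --> a / c.
  have num : (fun n => a + b * q^-1 ^+ n) @ \oo --> a + b * 0.
    by apply: cvgD; [exact: cvg_cst|apply: cvgM => //; exact: cvg_cst].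
  have den : (fun n => c * (1 - q^-1 ^+ n)) @ \oo --> c * (1 - 0).
    by apply: cvgM; [exact: cvg_cst|apply: cvgB => //; exact: cvg_cst].
  rewrite mulr0 addr0 in num; rewrite subr0 mulr1 in den.
  by apply: cvgM num _; exact: cvgV den.
apply: cvg_trans lim; apply: near_eq_cvg; near=> n.
have qn0 : q ^+ n != 0 by rewrite expf_neq0.
rewrite uE; last by near: n; exact: nbhs_infty_ge.
rewrite exprVn.
have -> : c * (q ^+ n - 1) = q ^+ n * (c * (1 - (q ^+ n)^-1)) by field.
have -> : a * q ^+ n + b = q ^+ n * (a + b * (q ^+ n)^-1) by field.
by rewrite -mulf_div divff // mul1r.
Unshelve. all: by end_near.
Qed.

Theorem theorem1 (R : realType) (m : nat) (H : {group 'S_m})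
    (G K : set (tree_aut m)) :
  (2 <= m)%N ->
  G `<=` wreath H ->
  regular_branch_over G K ->
  let w := Omega (subgroup_index G K) in
  let Gbar := closure G in
  let h := hdim R H Gbar in
  let alpha := h * log_base R m #|H| / (m%:R - 1) in
  let beta := (\sum_(1 <= n < w.+1) s_level R G n
               - log_base R m (quotient_order G 1))
              / (m%:R - 1) in
  [/\ regular_branch_over Gbar (stab Gbar w),
      h = (log_base R m #|H|)^-1 *
          (log_base R m (quotient_order G 1)
           - \sum_(1 <= n < w.+1) s_level R G n / m%:R ^+ n)
    & forall n, (w <= n)%N ->
        log_base R m (quotient_order G n) = alpha * m%:R ^+ n + beta].
Proof.
move=> m2 GW rb w Gbar h alpha beta.
have [[sG ssG trG] _] := rb.
set q : R := m%:R; have q1 : 1 < q by rewrite ltr1n.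
have q0 : q != 0 by rewrite gt_eqF // (lt_trans ltr01).
have q10 : q - 1 != 0 by rewrite gt_eqF // subr_gt0.
pose a n := log_base R m (subgroup_index (stab G n) (stab G n.+1)).
pose L n := log_base R m (quotient_order G n).
have idx0 A n : is_subgroup A -> (0 < subgroup_index A (stab A n))%N.
  by move=> sA; have := index_stab_gt0 A 0 n sA; rewrite stab0.
have qE n : quotient_order G n = subgroup_index G (stab G n) by [].
have sE n : s_level R G n.+1 = q * a n - a n.+1 by [].
have L0 : L 0 = 0 by rewrite /L qE index_stab0 // log_base1.
have LS n : L n.+1 = L n + a n.
  by rewrite /L !qE index_stabS // log_baseM ?idx0 ?index_stab_gt0.
have a0 : a 0 = log_base R m (quotient_order G 1).
  by rewrite -[RHS]/(L 1) LS L0 add0r.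
have s0 n : (w < n)%N -> s_level R G n = 0.
  case: n => [//|n] wn; rewrite sE /a (index_stab_branch G K) //.
  by rewrite log_baseX ?index_stab_gt0 // subrr.
set S := \sum_(1 <= n < w.+1) s_level R G n / q ^+ n.
set B := \sum_(1 <= n < w.+1) s_level R G n - log_base R m (quotient_order G 1).
pose A := log_base R m (quotient_order G 1) - S.
have LE n : (w <= n)%N -> L n = (A * q ^+ n + B) / (q - 1).
  move=> wn; apply: (mulfI q10); rewrite (recurrence_sum q a (s_level R G)) //.
  rewrite (recurrence_term q a (s_level R G)) //.
  rewrite (big_nat_cut (s_level R G) w) //.
  rewrite (big_nat_cut (fun i => s_level R G i / q ^+ i) w) //; last first.
    by move=> k wk; rewrite s0 // mul0r.
  by rewrite [RHS]mulrC divfK // -/S /A /B -a0; ring.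
pose lH := log_base R m #|H|.
have lH0 : lH != 0 by rewrite log_base_neq0 // (wreath_transitive_gt1 H G).
pose V n := log_base R m (subgroup_index (wreath H) (stab (wreath H) n)).
have VE n : V n = lH * (q ^+ n - 1) / (q - 1).
  elim: n => [|n IH].
    rewrite /V index_stab0; last exact: subgroup_wreath.
    by rewrite log_base1 subrr mulr0 mul0r.
  have sW := subgroup_wreath H.
  rewrite /V index_wreathS log_baseM ?expn_gt0 ?idx0 ?cardG_gt0 //.
  by rewrite log_baseX ?idx0 // -/(V n) IH exprS -/lH -/q; field.
have hE : h = lH^-1 * A.
  have cvgu : (fun n => L n / V n) @ \oo --> A / lH.
    apply: (cvg_affine_exp_ratio _ q A B lH _ w) => // n wn.
    by rewrite LE // VE invf_div mulrA divfK.
  have -> : h = limn_inf (fun n => L n / V n).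
    rewrite /h /hdim; congr limn_inf; apply/funext => n.
    by rewrite index_stab_closure.
  rewrite mulrC cvg_limn_infE; first exact: cvg_lim cvgu.
  by apply/cvg_ex; exists (A / lH).
split=> [||n wn]; [exact: closure_regular_branch|exact: hE|].
rewrite -/(L n) LE // /alpha /beta hE -/lH -/B -/q.
by field; rewrite q10 lH0.
Qed.
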